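(* Let $s \ge 1$, let $M_0, M_1, \ldots, M_{s-1}$ be linear orders each equal to $\omega$ or $\omega^*$ which alternate (i.e. $M_{i+1} \neq M_i$ for all $i$), and let $m_i, n_i$ ($i < s$) be non-zero natural numbers. Let $A = M_0^{m_0} \cdot M_1^{m_1} \cdots M_{s-1}^{m_{s-1}}$ and $B = M_0^{n_0} \cdot M_1^{n_1} \cdots M_{s-1}^{n_{s-1}}$ with $A \neq B$ (i.e. $m_i \neq n_i$ for some $i$), let $t$ be the smallest $i$ such that $m_i \neq n_i$, and assume $m_t < n_t$. Then: (i) if $t = s-1$, then $l(A,B) = 2(m_0 + m_1 + \cdots + m_t)$; (ii) if $t = s-2$, then $l(A,B) = 2(m_0 + m_1 + \cdots + m_t) + 1$; (iii) if $t < s-2$, then $l(A,B) = 2(m_0 + m_1 + \cdots + m_t) + 2$.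
   Context: All orders are linear orders. $\omega^*$ is the reverse of $\omega$. For linear orders $X, Y$, $X \cdot Y$ denotes the anti-lexicographic product (''$Y$ copies of $X$''): the set of pairs $(x,y)$ with $x \in X$, $y \in Y$, ordered by comparing $y$ first and then $x$. $M^n$ denotes the product of $n$ copies of $M$. For $n \ge 1$, $X \equiv_n Y$ means player II has a winning strategy in the $n$-move Ehrenfeucht–Fraïssé game on $X$ and $Y$ (in each move player I picks an element of either structure and II picks an element of the other; II wins if the map sending the $i$th element chosen in $X$ to the $i$th chosen in $Y$ is an order-isomorphism of the induced substructures). $X \equiv Y$ (elementary equivalence) holds iff $X \equiv_n Y$ for all $n$. For $X \not\equiv Y$, $l(X,Y)$ is the non-zero natural number $n$ such that $X \equiv_n Y$ but $X \not\equiv_{n+1} Y$. *)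

(* Defs.v *)
From HB Require Import structures.
From mathcomp Require Import all_boot all_order.
Set Implicit Arguments.
Unset Strict Implicit.
Unset Printing Implicit Defensive.
Import Order.TTheory.
Local Open Scope order_scope.

(* Linear orders of arbitrary display, packed so that products of varying
   length can be formed by recursion. *)
Record linorder := LinOrder {
  lo_disp : Order.disp_t;
  lo_sort :> orderType lo_disp }.

Definition omega : linorder := LinOrder nat.
Definition omega_star : linorder := LinOrder (nat^d).

Definition lo_one : linorder := LinOrder 'I_1.

(* X . Y ("Y copies of X"). The library's lexicographic product compares the
   first component first, so a pair (x, y) is stored as (y, x). *)
Definition lo_mul (X Y : linorder) : linorder :=
  LinOrder (Y *l X).

(* X 0 . X 1 ... X k.-1; a single factor is returned as it is, so that
   lo_one only occurs for the empty product. *)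
Fixpoint lo_prod (X : nat -> linorder) (k : nat) : linorder :=
  match k with
  | 0 => lo_one
  | k'.+1 => if k' is 0 then X 0 else lo_mul (lo_prod X k') (X k')
  end.

Definition lo_exp (M : linorder) (n : nat) : linorder :=
  lo_prod (fun=> M) n.

Section Game.
Variables X Y : linorder.

(* A move of player I: an element of either structure. *)
Definition move := (X + Y)%type.

(* A strategy of player II: the reply to the current move of I, given the
   sequence of the previous moves of I. *)
Record strategy := Strategy {
  reply_inY : seq move -> X -> Y;
  reply_inX : seq move -> Y -> X }.

Definition round (sg : strategy) (h : seq move) (a : move) : X * Y :=
  match a with
  | inl x => (x, reply_inY sg h x)
  | inr y => (reply_inX sg h y, y)
  end.

(* The pairs chosen when I plays ms after the earlier moves h. *)
Fixpoint play (sg : strategy) (h ms : seq move) : seq (X * Y) :=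
  if ms is a :: ms' then round sg h a :: play sg (rcons h a) ms' else [::].

Definition partial_iso (ps : seq (X * Y)) : Prop :=
  forall p q, p \in ps -> q \in ps ->
    ((p.1 == q.1) = (p.2 == q.2)) /\ ((p.1 < q.1) = (p.2 < q.2)).

Definition winning (n : nat) (sg : strategy) : Prop :=
  forall ms : seq move, size ms = n -> partial_iso (play sg [::] ms).

Definition ef_equiv (n : nat) : Prop := exists sg : strategy, winning n sg.

(* l(X, Y) = n, as a relation; see is_l_uniq. *)
Definition is_l (n : nat) : Prop :=
  (0 < n)%N /\ ef_equiv n /\ ~ ef_equiv n.+1.

Lemma play_cat sg h ms1 ms2 :
  play sg h (ms1 ++ ms2) = play sg h ms1 ++ play sg (h ++ ms1) ms2.
Proof.
elim: ms1 h => [|a ms1 IH] h /=; first by rewrite cats0.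
by rewrite IH cat_rcons.
Qed.

Lemma ef_equiv_le m n : (m <= n)%N -> ef_equiv n -> ef_equiv m.
Proof.
move=> le_mn [sg win]; exists sg => -[|a ms] sz; first by [].
have szn : size ((a :: ms) ++ nseq (n - m) a) = n.
  by rewrite size_cat size_nseq sz subnKC.
move=> p q pin qin; apply: (win _ szn);
  by rewrite play_cat mem_cat ?pin ?qin.
Qed.

Lemma is_l_uniq m n : is_l m -> is_l n -> m = n.
Proof.
move=> [_ [em nm]] [_ [en nn]]; case: (ltngtP m n) => // lt.
- by case: nm; apply: ef_equiv_le en.
- by case: nn; apply: ef_equiv_le em.
Qed.

End Game.

(* Main.v *)
Require Import Defs.
From HB Require Import structures.
From mathcomp Require Import all_boot all_order.
From mathcomp Require boolp.
From mathcomp Require Import zify.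
Set Implicit Arguments.
Unset Strict Implicit.
Unset Printing Implicit Defensive.
Import Order.TTheory.

(** A move in the Ehrenfeucht-Fraisse game cuts both orders in two, after which
    the game is played independently on the two lower and the two upper parts.
    In omega . X the copies of X are the limit points (and possibly the least
    element), and recognizing such a point costs two quantifiers.  Hence
    omega . X and omega . Y are (n+2)-equivalent iff X and Y are n-equivalent,
    where the direction from right to left needs that X and Y have no least
    element, and dually for omega^*.  Stripping common least significant factors
    therefore lowers l(A, B) by 2 each, and what is left is one of
    - omega versus omega^(d+2): only the latter has a limit point which is not
      the least element, which takes 3 moves to see;
    - omega . X versus omega . Y with X = (omega^* )^a and omega the first factor
      of Y: in 2 moves, X has a last element but Y has none;
    - omega . X versus omega . Y with X and Y without endpoints (so 2-equivalent),
      X starting with omega^* and Y with omega: in 3 moves, every element of X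
      has an immediate predecessor but not every element of Y does. *)

(** * Back-and-forth equivalence of suborders *)

Definition below T (r : T -> T -> Prop) (P : T -> Prop) x z := P z /\ r z x.
Definition above T (r : T -> T -> Prop) (P : T -> Prop) x z := P z /\ r x z.

(* Back-and-forth equivalence of the suborders P and Q.  The second conjunct swaps
   the two sides, so that it is [forth] of the converse and [bf_sym] is immediate. *)
Fixpoint bf (n : nat) T U (r : T -> T -> Prop) (s : U -> U -> Prop)
    (P : T -> Prop) (Q : U -> Prop) : Prop :=
  if n is n'.+1 then
    (forall x, P x -> exists2 y, Q y &
       bf n' r s (below r P x) (below s Q y) /\
       bf n' r s (above r P x) (above s Q y)) /\
    (forall y, Q y -> exists2 x, P x &
       bf n' s r (below s Q y) (below r P x) /\
       bf n' s r (above s Q y) (above r P x))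
  else True.

Arguments bf : simpl never.

Definition forth n T U (r : T -> T -> Prop) (s : U -> U -> Prop) P Q :=
  forall x, P x -> exists2 y, Q y &
    bf n r s (below r P x) (below s Q y) /\
    bf n r s (above r P x) (above s Q y).

Lemma bf_forth n T U (r : T -> T -> Prop) (s : U -> U -> Prop) P Q :
  bf n.+1 r s P Q -> forth n r s P Q.
Proof. by case. Qed.

Definition full T (x : T) := True.

Lemma bf_sym n T U (r : T -> T -> Prop) (s : U -> U -> Prop) P Q :
  bf n r s P Q -> bf n s r Q P.
Proof. by case: n => //= n [? ?]; split. Qed.

Lemma bf_pred n T U (r : T -> T -> Prop) (s : U -> U -> Prop) P Q :
  bf n.+1 r s P Q -> bf n r s P Q.
Proof.
elim: n T U r s P Q => // n IH T U r s P Q [fw bw].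
by split=> [x Px|y Qy]; [have [z ? [? ?]] := fw x Px|have [z ? [? ?]] := bw y Qy];
  exists z => //; split; apply: IH.
Qed.

Lemma bf_trans n T U V (r : T -> T -> Prop) (s : U -> U -> Prop)
    (u : V -> V -> Prop) P Q S :
  bf n r s P Q -> bf n s u Q S -> bf n r u P S.
Proof.
elim: n T U V r s u P Q S => // n IH T U V r s u P Q S [fw1 bw1] [fw2 bw2].
split=> [x Px|z Sz].
  have [y Qy [lo1 hi1]] := fw1 x Px; have [z Sz [lo2 hi2]] := fw2 y Qy.
  by exists z => //; split; [apply: IH lo1 lo2|apply: IH hi1 hi2].
have [y Qy [lo1 hi1]] := bw2 z Sz; have [x Px [lo2 hi2]] := bw1 y Qy.
by exists x => //; split; [apply: IH lo1 lo2|apply: IH hi1 hi2].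
Qed.

(** Any [R]-related element is a good reply, because [R] restricts to the two lower and the two
    upper parts. A relation is used instead of a function so that the swapped half is the same claim
    for the converse of [R]. *)
Lemma bf_iso n T U (R : T -> U -> Prop) (r : T -> T -> Prop) (s : U -> U -> Prop)
    P Q :
  (forall x y x' y', R x y -> R x' y' -> (r x x' <-> s y y')) ->
  (forall x, P x -> exists2 y, Q y & R x y) ->
  (forall y, Q y -> exists2 x, P x & R x y) ->
  bf n r s P Q.
Proof.
elim: n T U R r s P Q => // n IH.
have half T U (R : T -> U -> Prop) r s P Q :
    (forall x y x' y', R x y -> R x' y' -> (r x x' <-> s y y')) ->
    (forall x, P x -> exists2 y, Q y & R x y) ->
    (forall y, Q y -> exists2 x, P x & R x y) -> forth n r s P Q.
  move=> mono tot sur x Px; have [y Qy Rxy] := tot x Px; exists y => //.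
  by split; (apply: (IH _ _ R); first exact: mono) => z;
    rewrite /below /above => -[Hz lt_z];
    first [have [w Hw Rw] := tot z Hz | have [w Hw Rw] := sur z Hz];
    exists w => //; split=> //;
    have := mono _ _ _ _ Rw Rxy; have := mono _ _ _ _ Rxy Rw; tauto.
move=> T U R r s P Q mono tot sur; split; first exact: half mono tot sur.
apply: (half _ _ (fun y x => R x y) _ _ _ _ _ sur tot) => y x y' x' Rxy Rxy'.
by rewrite (mono _ _ _ _ Rxy Rxy').
Qed.

Lemma bf_iff n T (r : T -> T -> Prop) (P P' : T -> Prop) :
  (forall x, P x <-> P' x) -> bf n r r P P'.
Proof.
move=> PP'; apply: (@bf_iso _ _ _ eq) => [x _ x' _ <- <-|x /PP' ?|x /PP' ?] //;
  by exists x.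
Qed.

Lemma bf_ext n T U (r : T -> T -> Prop) (s : U -> U -> Prop) P P' Q Q' :
  (forall x, P x <-> P' x) -> (forall x, Q x <-> Q' x) ->
  bf n r s P Q -> bf n r s P' Q'.
Proof.
move=> PP' QQ' PQ; apply: (bf_trans (Q := P)); first by apply: bf_iff => x; split=> /PP'.
exact: bf_trans PQ (bf_iff _ _ QQ').
Qed.

Lemma bf_empty n T U (r : T -> T -> Prop) (s : U -> U -> Prop) P Q :
  (forall x, ~ P x) -> (forall x, ~ Q x) -> bf n r s P Q.
Proof. by move=> P0 Q0; case: n => // n; split=> [x /P0|x /Q0]. Qed.

Lemma bf1 T U (r : T -> T -> Prop) (s : U -> U -> Prop) (P : T -> Prop) (Q : U -> Prop) :
  (ex P <-> ex Q) -> bf 1 r s P Q.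
Proof.
move=> [PQ QP]; split=> [x Px|y Qy]; first by case: PQ => [|y]; [exists x|exists y].
by case: QP => [|x]; [exists y|exists x].
Qed.

Lemma bf_ex n T U (r : T -> T -> Prop) (s : U -> U -> Prop) P Q :
  bf n.+1 r s P Q -> ex P -> ex Q.
Proof. by case=> fw _ [x /fw[y Qy _]]; exists y. Qed.

(* Reversing the order when b is false reduces every claim about omega^* to one
   about omega. *)
Definition dir (b : bool) T (r : T -> T -> Prop) x y := if b then r x y else r y x.

Lemma dirK b T (r : T -> T -> Prop) : dir b (dir b r) = r.
Proof. by case: b. Qed.

Lemma dirN b T (r : T -> T -> Prop) x y : dir (~~ b) r x y = dir b r y x.
Proof. by case: b. Qed.

Lemma bf_dir b n T U (r : T -> T -> Prop) (s : U -> U -> Prop) P Q :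
  bf n r s P Q -> bf n (dir b r) (dir b s) P Q.
Proof.
case: b => //; elim: n T U r s P Q => // n IH T U r s P Q [fw bw].
by split=> [x Px|y Qy]; [have [z ? [? ?]] := fw x Px|have [z ? [? ?]] := bw y Qy];
  exists z => //; split; apply: IH.
Qed.

Definition has_max T (r : T -> T -> Prop) (P : T -> Prop) :=
  exists2 x, P x & forall y, P y -> ~ r x y.

(** A last element has an empty upper part. One move picks it, and one more would find a point above
    its reply. *)
Lemma bf_has_max n T U (r : T -> T -> Prop) (s : U -> U -> Prop) P Q :
  bf n.+2 r s P Q -> has_max r P -> has_max s Q.
Proof.
move=> /bf_forth fw [x /fw[y Qy [_ /bf_sym hi]] xmax]; exists y => // z Qz yz.
by have [|w [/xmax]] := bf_ex hi; first by exists z.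
Qed.

Definition strict T (r : T -> T -> Prop) :=
  (forall x, ~ r x x) /\ (forall y x z, r x y -> r y z -> r x z).

Lemma strict_asym T (r : T -> T -> Prop) x y : strict r -> r x y -> ~ r y x.
Proof. by case=> irr tr xy yx; apply: (irr x); apply: tr xy yx. Qed.

Lemma strict_dir b T (r : T -> T -> Prop) : strict r -> strict (dir b r).
Proof. by case: b => // -[irr tr]; split=> // y x z xy yz; apply: tr yz xy. Qed.

(** Ordered sums: the reply is taken in the summand where the move was made. The untouched summand
    goes whole into one of the two parts and only loses a move, by [bf_pred]. *)
Lemma bf_union n T U (r : T -> T -> Prop) (s : U -> U -> Prop)
    (P P' : T -> Prop) (Q Q' : U -> Prop) :
  strict r -> strict s ->
  (forall x x', P x -> P' x' -> r x x') -> (forall y y', Q y -> Q' y' -> s y y') ->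
  bf n r s P Q -> bf n r s P' Q' ->
  bf n r s (fun x => P x \/ P' x) (fun y => Q y \/ Q' y).
Proof.
elim: n T U r s P P' Q Q' => // n IH.
have half T U (r : T -> T -> Prop) (s : U -> U -> Prop)
    (P P' : T -> Prop) (Q Q' : U -> Prop) :
    strict r -> strict s ->
    (forall x x', P x -> P' x' -> r x x') -> (forall y y', Q y -> Q' y' -> s y y') ->
    bf n.+1 r s P Q -> bf n.+1 r s P' Q' ->
    forth n r s (fun x => P x \/ P' x) (fun y => Q y \/ Q' y).
  move=> sr ss rPP' sQQ' E E' x [Px|Px].
    have fw := bf_forth E; have [y Qy [lo hi]] := fw x Px; exists y; first by left.
    split.
      apply: bf_ext lo => z; rewrite /below; split; try tauto.
        by case=> [[//|Pz] zx]; case: (strict_asym sr zx); apply: rPP'.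
      by case=> [[//|Qz] zy]; case: (strict_asym ss zy); apply: sQQ'.
    have := IH _ _ r s _ _ _ _ sr ss _ _ hi (bf_pred E').
    move=> /(_ (fun _ _ H => rPP' _ _ (proj1 H)) (fun _ _ H => sQQ' _ _ (proj1 H))).
    apply: bf_ext => z; rewrite /above; split; try tauto.
      by case=> [[? ?]|Pz]; [tauto|split; [right|apply: rPP']].
    by case=> [[? ?]|Qz]; [tauto|split; [right|apply: sQQ']].
  have fw := bf_forth E'; have [y Qy [lo hi]] := fw x Px; exists y; first by right.
  split; last first.
    apply: bf_ext hi => z; rewrite /above; split; try tauto.
      by case=> [[Pz|//] xz]; case: (strict_asym sr xz); apply: rPP'.
    by case=> [[Qz|//] yz]; case: (strict_asym ss yz); apply: sQQ'.
  have := IH _ _ r s _ _ _ _ sr ss _ _ (bf_pred E) lo.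
  move=> /(_ (fun _ _ H H' => rPP' _ _ H (proj1 H')) (fun _ _ H H' => sQQ' _ _ H (proj1 H'))).
  apply: bf_ext => z; rewrite /below; split; try tauto.
    by case=> [Pz|[? ?]]; [split; [left|apply: rPP']|tauto].
  by case=> [Qz|[? ?]]; [split; [left|apply: sQQ']|tauto].
move=> T U r s P P' Q Q' sr ss rPP' sQQ' E E'; split; first exact: half.
by apply: half => //; apply: bf_sym.
Qed.

(** * Multiplication by omega *)

Definition lexn T (r : T -> T -> Prop) (a b : T * nat) :=
  r a.1 b.1 \/ a.1 = b.1 /\ a.2 < b.2.

Lemma strict_lexn T (r : T -> T -> Prop) : strict r -> strict (lexn r).
Proof.
move=> [irr tr]; split=> [x [/irr//|[_]]|y x z]; first by rewrite ltnn.
case=> [xy|[exy xy]] [yz|[eyz yz]]; [left; exact: tr xy yz|left|left|right].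
- by rewrite -eyz.
- by rewrite exy.
- by split; [rewrite exy|apply: ltn_trans yz].
Qed.

(* In the order omega . r, [copies P] is omega . P, and [tail x0 i P] is a final
   segment of omega . ({x0} + P) when x0 lies below P. *)
Definition copies T (P : T -> Prop) (z : T * nat) := P z.1.
Definition tail T x0 i (P : T -> Prop) (z : T * nat) := z.1 = x0 /\ i <= z.2 \/ P z.1.
Definition seg T (x0 : T) i j (z : T * nat) := z.1 = x0 /\ i <= z.2 < j.

Lemma bf_seg n T U (r : T -> T -> Prop) (s : U -> U -> Prop) x y i j k :
  strict r -> strict s -> 
  bf n (lexn r) (lexn s) (seg x i (i + k)) (seg y j (j + k)).
Proof.
move=> [irr _] [irs _].
apply: (@bf_iso _ _ _ (fun z w => [/\ z.1 = x, w.1 = y & z.2 + j = w.2 + i])).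
- move=> [? a] [? b] [? a'] [? b'] /= [-> -> e] [-> -> e'].
  split; first by move=> [/irr//|[_ /= lt_a]]; right; split=> //=; lia.
  by move=> [/irs//|[_ /= lt_b]]; right; split=> //=; lia.
- move=> [? a] [/= -> ia]; exists (y, a + j - i); split=> //=; lia.
- move=> [? a] [/= -> ia]; exists (x, a + i - j); split=> //=; lia.
Qed.

(** * Cuts of tails and of copies *)

Lemma below_tail_bot T (r : T -> T -> Prop) P x0 i k w :
  strict r -> (forall x, P x -> r x0 x) ->
  below (lexn r) (tail x0 i P) (x0, k) w <-> seg x0 i k w.
Proof.
move=> sr gtx0; case: w => w l; rewrite /below /tail /lexn /seg /=; split.
  case=> [[[-> il]|Pw] [lt_w|[e lk]]]; try by case: (proj1 sr _ lt_w).
  - by split=> //; lia.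
  - by case: (strict_asym sr lt_w); apply: gtx0.
  - by case: (proj1 sr x0); rewrite -{2}e; apply: gtx0.
by move=> [-> ik]; split; [left; split=> //; lia|right; split=> //; lia].
Qed.

Lemma above_tail_bot T (r : T -> T -> Prop) P x0 i k w :
  strict r -> (forall x, P x -> r x0 x) -> i <= k ->
  above (lexn r) (tail x0 i P) (x0, k) w <-> tail x0 k.+1 P w.
Proof.
move=> sr gtx0 ik; case: w => w l; rewrite /above /tail /lexn /=; split.
  case=> [[[-> il]|Pw] [lt_w|[e lk]]]; try by [right|case: (proj1 sr _ lt_w)].
  by left.
case=> [[-> kl]|Pw]; last by split; [right|left; apply: gtx0].
by split; [left; split=> //; lia|right].
Qed.

Lemma below_tail T (r : T -> T -> Prop) P x0 i z k w :
  strict r -> (forall x, P x -> r x0 x) -> P z ->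
  below (lexn r) (tail x0 i P) (z, k) w <-> tail x0 i (below r P z) w \/ seg z 0 k w.
Proof.
move=> sr gtx0 Pz; case: w => w l; rewrite /below /tail /lexn /seg /=; split.
  case=> [[[-> il]|Pw] [lt_w|[e lk]]]; try by [right|left; tauto].
case=> [[[-> il]|[Pw lt_w]]|[-> lk]]; first by split; [left|left; apply: gtx0].
  by split; [right|left].
by split; right.
Qed.

Lemma above_tail T (r : T -> T -> Prop) P x0 i z k w :
  strict r -> (forall x, P x -> r x0 x) -> P z ->
  above (lexn r) (tail x0 i P) (z, k) w <-> tail z k.+1 (above r P z) w.
Proof.
move=> sr gtx0 Pz; case: w => w l; rewrite /above /tail /lexn /=; split.
  case=> [[[-> il]|Pw] [lt_w|[e lk]]]; try tauto.
  - by case: (strict_asym sr lt_w); apply: gtx0.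
  - by left.
  - by left.
case=> [[-> kl]|[Pw lt_w]]; last by split; [right|left].
by split; right.
Qed.

Lemma below_copies T (r : T -> T -> Prop) P z k w : P z ->
  below (lexn r) (copies P) (z, k) w <-> copies (below r P z) w \/ seg z 0 k w.
Proof.
move=> Pz; case: w => w l; rewrite /below /copies /lexn /seg /=; split.
  by case=> [Pw [lt_w|[e lk]]]; [left|right].
by case=> [[Pw lt_w]|[-> lk]]; split=> //; [left|right].
Qed.

Lemma above_copies T (r : T -> T -> Prop) P z k w : P z ->
  above (lexn r) (copies P) (z, k) w <-> tail z k.+1 (above r P z) w.
Proof.
move=> Pz; case: w => w l; rewrite /above /copies /tail /lexn /=; split.
  by case=> [Pw [lt_w|[e lk]]]; [right|left].
by case=> [[-> lk]|[Pw lt_w]]; split=> //; [right|left].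
Qed.

(** A move in the bottom copy is answered at the same distance from the start. A move [(z, k)]
    higher up is answered by [(y, k)], with [y] the reply to [z]: below, this leaves a smaller tail
    followed by [k] points, and above, a tail whose bottom copy is that of [z]. With only two moves
    all that matters is whether something lies below the chosen point, since nothing is last in a
    tail. *)
Lemma bf_tail n T U (r : T -> T -> Prop) (s : U -> U -> Prop)
    (P : T -> Prop) (Q : U -> Prop) x0 y0 i j :
  strict r -> strict s ->
  (forall x, P x -> r x0 x) -> (forall y, Q y -> s y0 y) ->
  bf n r s P Q -> bf n.+2 (lexn r) (lexn s) (tail x0 i P) (tail y0 j Q).
Proof.
elim: n T U r s P Q x0 y0 i j => [|n IH].
  have half T U (r : T -> T -> Prop) (s : U -> U -> Prop)
      (P : T -> Prop) (Q : U -> Prop) x0 y0 i j : strict r -> strict s ->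
      (forall x, P x -> r x0 x) -> (forall y, Q y -> s y0 y) ->
      forth 1 (lexn r) (lexn s) (tail x0 i P) (tail y0 j Q).
    move=> sr ss gtx0 gty0 x tx.
    have hi S (q : S -> S -> Prop) z0 k (W : S -> Prop) (z : S * nat) :
        tail z0 k W z -> ex (above (lexn q) (tail z0 k W) z).
      case: z => z m [[/= -> km]|/= Wz]; [exists (z0, m.+1)|exists (z, m.+1)].
        by split; [left; split=> //=; lia|right].
      by split; [right|right].
    have [Ex|NEx] := boolp.pselect (ex (below (lexn r) (tail x0 i P) x)).
      have ty : tail y0 j Q (y0, j.+1) by left; split=> /=.
      exists (y0, j.+1) => //; split; apply: bf1; split=> // _; try exact: hi.
      by exists (y0, j); split; [left|right].
    have ty : tail y0 j Q (y0, j) by left; split=> /=.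
    exists (y0, j) => //; split; apply: bf1; split=> //; try by move=> _; apply: hi.
    by move=> [w]; rewrite below_tail_bot // => -[_]; lia.
  by move=> T U r s P Q x0 y0 i j sr ss gtx0 gty0 _; split; apply: half.
have half T U (r : T -> T -> Prop) (s : U -> U -> Prop)
    (P : T -> Prop) (Q : U -> Prop) x0 y0 i j : strict r -> strict s ->
    (forall x, P x -> r x0 x) -> (forall y, Q y -> s y0 y) ->
    bf n.+1 r s P Q ->
    forth n.+2 (lexn r) (lexn s) (tail x0 i P) (tail y0 j Q).
  move=> sr ss gtx0 gty0 E [z k] [[/= -> ik]|/= Pz].
    exists (y0, j + (k - i)); first by left; split=> //=; lia.
    split.
      have := bf_seg n.+2 x0 y0 i j (k - i) sr ss; rewrite subnKC //.
      by apply: bf_ext => w; rewrite below_tail_bot.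
    have := IH _ _ _ _ _ _ x0 y0 k.+1 (j + (k - i)).+1 sr ss gtx0 gty0 (bf_pred E).
    by apply: bf_ext => w; rewrite above_tail_bot //; lia.
  have [y Qy [lo hi]] := bf_forth E Pz.
  exists (y, k); first by right.
  split; last first.
    have := IH _ _ _ _ _ _ z y k.+1 k.+1 sr ss (fun _ => @proj2 _ _) (fun _ => @proj2 _ _) hi.
    by apply: bf_ext => w; rewrite above_tail.
  have lo' := IH _ _ _ _ _ _ x0 y0 i j sr ss (fun x H => gtx0 x (proj1 H)) (fun y H => gty0 y (proj1 H)) lo.
  have := bf_union (strict_lexn sr) (strict_lexn ss) _ _ lo' (bf_seg _ z y 0 0 k sr ss).
  move=> H; apply: bf_ext (H _ _) => [w|w|x x' + [e _]|x x' + [e _]]; rewrite ?below_tail //.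
    by case=> [[xe _]|[_ ?]]; left; rewrite e // xe; apply: gtx0.
  by case=> [[xe _]|[_ ?]]; left; rewrite e // xe; apply: gty0.
move=> T U r s P Q x0 y0 i j sr ss gtx0 gty0 E; split; apply: half => //.
exact: bf_sym.
Qed.

Definition no_min T (r : T -> T -> Prop) (P : T -> Prop) :=
  forall x, P x -> ex (below r P x).

Lemma no_min_below T (r : T -> T -> Prop) P x :
  strict r -> no_min r P -> no_min r (below r P x).
Proof.
move=> sr mP y [Py yx]; have [z [Pz zy]] := mP y Py.
by exists z; split=> //; split=> //; apply: (proj2 sr) zy yx.
Qed.

(** The reply to [(z, k)] is [(y, k)], with [y] the reply to [z]. The part of [P] below [z] is again
    nonempty without least element, so the induction covers the lower copies; the upper parts are
    tails, covered by [bf_tail]. With two moves it is enough that every point has points on both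
    sides. *)
Lemma bf_copies n T U (r : T -> T -> Prop) (s : U -> U -> Prop)
    (P : T -> Prop) (Q : U -> Prop) :
  strict r -> strict s -> ex P -> ex Q -> no_min r P -> no_min s Q ->
  bf n r s P Q -> bf n.+2 (lexn r) (lexn s) (copies P) (copies Q).
Proof.
elim: n T U r s P Q => [|n IH].
  have half T U (r : T -> T -> Prop) (s : U -> U -> Prop)
      (P : T -> Prop) (Q : U -> Prop) : ex Q -> no_min r P -> no_min s Q ->
      forth 1 (lexn r) (lexn s) (copies P) (copies Q).
    have hi S (q : S -> S -> Prop) (W : S -> Prop) (z : S * nat) :
        copies W z -> ex (above (lexn q) (copies W) z).
      by case: z => z m Wz; exists (z, m.+1); split=> //; right.
    have lo S (q : S -> S -> Prop) (W : S -> Prop) (z : S * nat) :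
        no_min q W -> copies W z -> ex (below (lexn q) (copies W) z).
      by move=> mW /mW[w [Ww lt_w]]; exists (w, 0); split=> //; left.
    move=> [y Qy] mP mQ x Px; exists (y, 0) => //.
    by split; apply: bf1; split=> _; [apply: lo|apply: lo|apply: hi|apply: hi].
  by move=> T U r s P Q sr ss xP xQ mP mQ _; split; apply: half.
have half T U (r : T -> T -> Prop) (s : U -> U -> Prop)
    (P : T -> Prop) (Q : U -> Prop) :
    strict r -> strict s -> no_min r P -> no_min s Q ->
    bf n.+1 r s P Q -> forth n.+2 (lexn r) (lexn s) (copies P) (copies Q).
  move=> sr ss mP mQ E [z k] Pz; have [y Qy [lo hi]] := bf_forth E Pz.
  exists (y, k) => //; split; last first.
    have := bf_tail k.+1 k.+1 sr ss (fun _ => @proj2 _ _) (fun _ => @proj2 _ _) hi.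
    by apply: bf_ext => w; rewrite above_copies.
  have lo' := IH _ _ _ _ _ _ sr ss (mP _ Pz) (mQ _ Qy)
    (no_min_below (x := z) sr mP) (no_min_below (x := y) ss mQ) lo.
  have := bf_union (strict_lexn sr) (strict_lexn ss) _ _ lo' (bf_seg _ z y 0 0 k sr ss).
  by move=> H; apply: bf_ext (H _ _) => [w|w|x x' [_ ?] [e _]|x x' [_ ?] [e _]];
    rewrite ?below_copies //; left; rewrite e.
move=> T U r s P Q sr ss _ _ mP mQ E; split; apply: half => //.
exact: bf_sym.
Qed.

(** * Cancelling a factor omega *)

Lemma tail_no_max T (r : T -> T -> Prop) x0 i P : ~ has_max (lexn r) (tail x0 i P).
Proof.
case=> -[x k] tx /(_ (x, k.+1)) H; apply: H; last by right.
by case: tx => [[/= -> ik]|]; [left; split=> //=; lia|right].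
Qed.

Lemma copies_no_max T (r : T -> T -> Prop) P : ~ has_max (lexn r) (copies P).
Proof. by case=> -[x k] tx /(_ (x, k.+1)) H; apply: H => //; right. Qed.

Lemma below_succ_has_max T (r : T -> T -> Prop) (W : T * nat -> Prop) y k :
  strict r -> W (y, k) -> has_max (lexn r) (below (lexn r) W (y, k.+1)).
Proof.
move=> sr Wy; exists (y, k); first by split=> //; right.
move=> [z l] [_ [/= lt_z|[/= -> lk]]] [/= lt_y|[/= e kl]].
- exact: strict_asym lt_z lt_y.
- by apply: (proj1 sr y); rewrite {1}e.
- exact: (proj1 sr y).
- by move: lk kl; lia.
Qed.

(** The limit point [(x, 0)] has no last element below it, and the moves left after it is played
    suffice to check this for the reply [(y, k)]. Hence [k = 0] and [y] is in [Q], so [y] is a reply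
    to [x]; both parts are tails again. *)
Lemma tail_bf n T U (r : T -> T -> Prop) (s : U -> U -> Prop)
    (P : T -> Prop) (Q : U -> Prop) x0 y0 i j :
  strict r -> strict s ->
  (forall x, P x -> r x0 x) -> (forall y, Q y -> s y0 y) ->
  bf n.+2 (lexn r) (lexn s) (tail x0 i P) (tail y0 j Q) -> bf n r s P Q.
Proof.
elim: n T U r s P Q x0 y0 i j => // n IH.
have half T U (r : T -> T -> Prop) (s : U -> U -> Prop)
    (P : T -> Prop) (Q : U -> Prop) x0 y0 i j : strict r -> strict s ->
    (forall x, P x -> r x0 x) -> (forall y, Q y -> s y0 y) ->
    bf n.+3 (lexn r) (lexn s) (tail x0 i P) (tail y0 j Q) -> forth n r s P Q.
  move=> sr ss gtx0 gty0 E x Px.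
  have /(bf_forth E)[[y k] ty [lo hi]] : tail x0 i P (x, 0) by right.
  have {}lo : bf n.+2 (lexn r) (lexn s) (tail x0 i (below r P x))
      (below (lexn s) (tail y0 j Q) (y, k)).
    apply: bf_ext lo => // w; rewrite below_tail //.
    by split; [case=> // -[_]; lia|left].
  have mx := @tail_no_max _ r x0 i (below r P x).
  (* Below a point that is not a limit there is a last element, or nothing. *)
  have Qy : Q y.
    case: ty => // -[/= ey jk]; case: mx; apply: bf_has_max (bf_sym lo) _.
    rewrite ey; have [|w] := bf_ex lo; first by exists (x0, i); left.
    rewrite ey below_tail_bot // => -[_ jwk].
    have [l -> jl]: exists2 l, k = l.+1 & j <= l by exists k.-1; lia.
    by apply: below_succ_has_max => //; left.
  exists y => //; case: k => [|k] in ty lo hi *; last first.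
    case: mx; apply: bf_has_max (bf_sym lo) _.
    by apply: below_succ_has_max => //; right.
  split.
    apply: (IH _ _ _ _ _ _ x0 y0 i j) => // [z []|z []|]; auto.
    apply: bf_ext lo => // w; rewrite below_tail //.
    by split; [case=> // -[_]; lia|left].
  apply: (IH _ _ _ _ _ _ x y 1 1) => // [z []|z []|] //.
  by apply: bf_ext hi => w; rewrite above_tail.
move=> T U r s P Q x0 y0 i j sr ss gtx0 gty0 E; split.
  exact: half E.
by apply: half (bf_sym E).
Qed.

(** As for tails, [(x, 0)] can only be answered by some [(y, 0)], since a point [(y, k.+1)] has a
    last element below it. The lower parts are copies again and the upper ones are tails, left to
    [tail_bf]. *)
Lemma copies_bf n T U (r : T -> T -> Prop) (s : U -> U -> Prop)
    (P : T -> Prop) (Q : U -> Prop) : strict r -> strict s ->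
  bf n.+2 (lexn r) (lexn s) (copies P) (copies Q) -> bf n r s P Q.
Proof.
elim: n T U r s P Q => // n IH.
have half T U (r : T -> T -> Prop) (s : U -> U -> Prop)
    (P : T -> Prop) (Q : U -> Prop) : strict r -> strict s ->
    bf n.+3 (lexn r) (lexn s) (copies P) (copies Q) -> forth n r s P Q.
  move=> sr ss E x Px.
  have /(bf_forth E)[[y k] Qy [lo hi]] : copies P (x, 0) by [].
  have {}lo : bf n.+2 (lexn r) (lexn s) (copies (below r P x))
      (below (lexn s) (copies Q) (y, k)).
    apply: bf_ext lo => // w; rewrite below_copies //.
    by split; [case=> // -[_]; lia|left].
  exists y => //; case: k => [|k] in Qy lo hi *; last first.
    case: (@copies_no_max _ r (below r P x)); apply: bf_has_max (bf_sym lo) _.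
    exact: below_succ_has_max.
  split.
    apply: IH => //; apply: bf_ext lo => // w; rewrite below_copies //.
    by split; [case=> // -[_]; lia|left].
  apply: (@tail_bf _ _ _ _ _ _ _ x y 1 1) => // [z []|z []|] //.
  by apply: bf_ext hi => w; rewrite above_copies.
move=> T U r s P Q sr ss E; split; first exact: half E.
by apply: half (bf_sym E).
Qed.

(** * Products of omega and its reverse *)

(* A list of booleans denotes the product of its entries, with true for omega and
   false for omega^*; the head is the least significant factor. *)
Fixpoint carrier (l : seq bool) : Type :=
  if l is _ :: l' then (carrier l' * nat)%type else unit.

Fixpoint wlt (l : seq bool) : carrier l -> carrier l -> Prop :=
  if l is b :: l' then dir b (lexn (dir b (@wlt l'))) else fun _ _ => False.

(** In a power of a single factor [b] this is the least element in the direction [b]. In general it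
    shows that the carrier is inhabited. *)
Fixpoint origin (l : seq bool) : carrier l :=
  if l is _ :: l' then (origin l', 0) else tt.

Lemma strict_wlt l : strict (@wlt l).
Proof.
elim: l => [|b l IH]; first by split=> [x []|y x z []].
by apply/strict_dir/strict_lexn/strict_dir.
Qed.

Lemma strict_dir_wlt b l : strict (dir b (@wlt l)).
Proof. exact/strict_dir/strict_wlt. Qed.

Definition wequiv n l l' := bf n (@wlt l) (@wlt l') (@full _) (@full _).

Lemma wequiv_dir b n l l' :
  wequiv n l l' <-> bf n (dir b (@wlt l)) (dir b (@wlt l')) (@full _) (@full _).
Proof. by split=> /(bf_dir b); rewrite ?dirK. Qed.

Lemma wequiv_consE n b l l' : wequiv n (b :: l) (b :: l') <->
  bf n (lexn (dir b (@wlt l))) (lexn (dir b (@wlt l')))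
    (@full (carrier l * nat)) (@full (carrier l' * nat)).
Proof. by rewrite (wequiv_dir b) /= !dirK. Qed.

Lemma ex_full l : ex (@full (carrier l)).
Proof. by exists (origin l). Qed.

(** An entry opposite to [b] allows an infinite descent: at that factor the natural number
    coordinate is increased, and more significant coordinates decide first. *)
Lemma no_min_wlt b l : ~~ b \in l -> no_min (dir b (@wlt l)) (@full _).
Proof.
elim: l => // c l IH; rewrite inE => bl [x i] _.
have [e|ne] := eqVneq c (~~ b).
  exists (x, i.+1); split=> //=; rewrite e.
  by case: (b); right.
have {}bl : ~~ b \in l by move: bl; rewrite eq_sym (negPf ne).
have {ne} -> : c = b by move: ne; case: (c); case: (b).
have [y [_ yx]] := IH bl x I; exists (y, 0); split=> //.
by rewrite /= dirK; left.
Qed.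

Lemma wequiv_cons n b l l' : ~~ b \in l -> ~~ b \in l' ->
  wequiv n l l' -> wequiv n.+2 (b :: l) (b :: l').
Proof.
move=> bl bl' /(wequiv_dir b) E; apply/wequiv_consE.
by apply: bf_copies E; try apply: strict_dir_wlt; try apply: ex_full; apply: no_min_wlt.
Qed.

Lemma wequiv_behead n b l l' : wequiv n.+2 (b :: l) (b :: l') -> wequiv n l l'.
Proof.
move=> /wequiv_consE E; apply/(wequiv_dir b).
by apply: copies_bf E; apply: strict_dir_wlt.
Qed.

(** Each factor of [p] adds two moves. As both kinds of factor occur in [l] and [l'], the orders
    have no endpoints and [wequiv_cons] always applies. *)
Lemma wequiv_cat n p l l' : (forall b, b \in l) -> (forall b, b \in l') ->
  wequiv n l l' -> wequiv (2 * size p + n) (p ++ l) (p ++ l').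
Proof.
move=> bl bl' E; elim: p => //= b p IH; rewrite mulnS.
by apply: wequiv_cons => //; rewrite mem_cat (bl, bl') orbT.
Qed.

Lemma wequiv_drop_cat n p l l' :
  wequiv (2 * size p + n) (p ++ l) (p ++ l') -> wequiv n l l'.
Proof. by elim: p => //= b p IH; rewrite mulnS => /wequiv_behead. Qed.

Lemma origin_min b k x :
  x = origin (nseq k b) \/ dir b (@wlt (nseq k b)) (origin (nseq k b)) x.
Proof.
elim: k x => [[]|k IH [x i]]; first by left.
rewrite /= dirK /lexn /=; case: (IH x) => [->|]; last by right; left.
by case: i => [|i]; [left|right; right].
Qed.

Lemma tail_origin b k z :
  tail (origin (nseq k b)) 0 (above (dir b (@wlt (nseq k b))) (@full _) (origin _)) z.
Proof. by case: (origin_min z.1) => [e|lt]; [left|right]. Qed.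

(** The least element is removed so that [bf_tail] iterates: the nonzero part of omega^(k+1) is a
    tail from index 1 in the copy of the origin, over the nonzero part of omega^k. *)
Lemma wequiv_pow_above b m n : m <= n ->
  bf (2 * m) (dir b (@wlt (nseq m b))) (dir b (@wlt (nseq n b)))
    (above (dir b (@wlt _)) (@full _) (origin _))
    (above (dir b (@wlt _)) (@full _) (origin _)).
Proof.
elim: m n => [|m IH] [|n] // /IH E; rewrite mulnS /= !dirK.
have sr l := strict_dir_wlt b l.
have := bf_tail 1 1 (sr _) (sr _) (fun _ => @proj2 _ _) (fun _ => @proj2 _ _) E.
have A k w : tail (origin (nseq k b)) 1
    (above (dir b (@wlt (nseq k b))) (@full _) (origin _)) w <->
    above (lexn (dir b (@wlt (nseq k b)))) (@full _) (origin (nseq k b), 0) w.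
  rewrite -(above_tail_bot (i := 0) _ (sr _)) //; last by move=> ? [].
  by split=> -[? ?]; split=> //; apply: tail_origin.
exact: bf_ext.
Qed.

Lemma wequiv_pow b m n : 0 < m -> m <= n ->
  wequiv (2 * m) (nseq m b) (nseq n b).
Proof.
case: m n => [|m] [|n] // _ /(@wequiv_pow_above b m n) E; rewrite mulnS; apply/wequiv_consE.
have sr l := strict_dir_wlt b l.
have := bf_tail 0 0 (sr _) (sr _) (fun _ => @proj2 _ _) (fun _ => @proj2 _ _) E.
by apply: bf_ext => w; split=> // _; apply: tail_origin.
Qed.

Lemma not_wequiv_pow b n : ~ wequiv 3 [:: b] (nseq n.+2 b).
Proof.
(* Both sides are omega . (1 + P), with P empty only on the left. *)
move=> /(@wequiv_consE 3 b [::] (nseq n.+1 b)) E.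
have sr l := strict_dir_wlt b l.
have {}E : bf 3 (lexn (dir b (@wlt [::]))) (lexn (dir b (@wlt (nseq n.+1 b))))
    (tail tt 0 (above (dir b (@wlt [::])) (@full _) tt))
    (tail (origin (nseq n.+1 b)) 0
      (above (dir b (@wlt (nseq n.+1 b))) (@full _) (origin _))).
  apply: bf_ext E => w; split=> // _; last exact: tail_origin.
  by left; split=> //; case: w => -[].
have gt0 S r x0 (y : S) : above r (@full S) x0 y -> r x0 y by case.
have [|x [_]] := bf_ex (bf_sym (tail_bf (sr _) (sr _) (gt0 _ _ _) (gt0 _ _ _) E)).
  by exists (origin (nseq n b), 1); split=> //=; rewrite dirK; right.
by case: (b).
Qed.

Lemma no_max_wlt b l : b \in l -> ~ has_max (dir b (@wlt l)) (@full _).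
Proof.
move=> bl [x _ xmax].
have [|y [_ yx]] := @no_min_wlt (~~ b) l _ x I; first by rewrite negbK.
by apply: (xmax y I); rewrite -dirN.
Qed.

(** In the direction [b] the origin is the last element on the left, while the entry [b] excludes a
    last element on the right. *)
Lemma not_wequiv_2 b a l : b \in l -> ~ wequiv 2 (nseq a (~~ b)) l.
Proof.
move=> bl /(wequiv_dir b)/bf_has_max H; case: (no_max_wlt bl); apply: H.
exists (origin _) => // y _ lt_y.
case: (@origin_min (~~ b) a y) => [e|lt_o].
  by move: lt_y; rewrite e; apply: (proj1 (strict_dir_wlt _ _)).
by apply: (strict_asym (strict_dir_wlt b _) lt_y); rewrite -dirN.
Qed.

(** In the direction [b], every [(x, i)] on the left has the immediate predecessor [(x, i.+1)].
    Player I picks the origin on the right, below which there are only whole copies of omega and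
    hence no last element. *)
Lemma not_wequiv_3 b l l' : ~ wequiv 3 (~~ b :: l) (b :: l').
Proof.
have sr := strict_dir_wlt (~~ b) l.
move=> /(wequiv_dir b)/bf_sym/bf_forth/(_ (origin (b :: l')) I).
case=> -[x i] _ [/bf_sym/bf_has_max E _].
case: (@copies_no_max _ (dir b (@wlt l')) (below (dir b (@wlt l')) (@full _) (origin l'))).
have [|[y j] [_ lt_y] ymax] := E.
  have flip T (r : T -> T -> Prop) u v : dir b (dir (~~ b) r) u v <-> r v u.
    by rewrite -dirN dirK.
  exists (x, i.+1) => [|[y j] [_]]; first by split=> //; apply/flip; right.
  move=> /flip[/= xy|[/= xy ij]] /flip[/= yx|[/= yx ji]].
  - exact: strict_asym xy yx.
  - by apply: (proj1 sr x); rewrite -{2}yx.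
  - by apply: (proj1 sr x); rewrite {1}xy.
  - by move: ij ji; lia.
move: lt_y ymax; rewrite /= dirK => lt_y ymax.
have C k w := @below_copies _ (dir b (@wlt l')) (@full _) (origin l') k w I.
exists (y, j); first by case/C: (conj I lt_y : below _ (copies (@full _)) _ _) => // -[_]; lia.
by move=> w cw; apply: ymax; apply/(C 0 w); left.
Qed.

(** Two moves see no more than endpoints, and neither order has one. *)
Lemma wequiv_2 l l' : (forall b, b \in l) -> (forall b, b \in l') -> wequiv 2 l l'.
Proof.
move=> bl bl'.
have half k k' : (forall b, b \in k) -> (forall b, b \in k') ->
    forth 1 (@wlt k) (@wlt k') (@full _) (@full _).
  move=> bk bk' x _; exists (origin k') => //; split; apply: bf1; split=> _.
  - exact: (@no_min_wlt true).
  - exact: (@no_min_wlt true).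
  - exact: (@no_min_wlt false).
  - exact: (@no_min_wlt false).
by split; apply: half.
Qed.

Lemma wequiv_1 l l' : wequiv 1 l l'.
Proof. by apply: bf1; split=> _; apply: ex_full. Qed.

(** * The game and back-and-forth equivalence *)

Definition lo_lt (X : linorder) (x y : X) : Prop := (x < y)%O.

Lemma strict_lo_lt X : strict (@lo_lt X).
Proof.
by split=> [x|y x z]; rewrite /lo_lt ?ltxx //; apply: lt_trans.
Qed.

(* The gap of ps selected by c: the points below those p with [c p] and above the
   others.  For most c both gaps are empty. *)
Definition gapl (X Y : linorder) (ps : seq (X * Y)) (c : X * Y -> bool) (x : X) :=
  forall p, p \in ps -> if c p then lo_lt x p.1 else lo_lt p.1 x.
Definition gapr (X Y : linorder) (ps : seq (X * Y)) (c : X * Y -> bool) (y : Y) :=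
  forall p, p \in ps -> if c p then lo_lt y p.2 else lo_lt p.2 y.

(** The strategy starts with an empty history: the moves that led to [ps] are forgotten and only the
    chosen pairs matter. *)
Definition winnable (X Y : linorder) n (ps : seq (X * Y)) :=
  exists sg : strategy X Y, forall ms, size ms = n ->
    partial_iso (ps ++ play sg [::] ms).

Lemma partial_iso_sub (X Y : linorder) (ps qs : seq (X * Y)) :
  {subset ps <= qs} -> partial_iso qs -> partial_iso ps.
Proof. by move=> sub iso p q /sub pqs /sub; apply: iso. Qed.

Definition after (X Y : linorder) (sg : strategy X Y) (a : move X Y) :=
  Strategy (fun h => reply_inY sg (a :: h)) (fun h => reply_inX sg (a :: h)).

Lemma play_after (X Y : linorder) (sg : strategy X Y) a h ms :
  play sg (a :: h) ms = play (after sg a) h ms.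
Proof.
elim: ms h => // b ms IH h; rewrite /= -IH.
by case: b.
Qed.

Lemma winnable_after (X Y : linorder) n (ps : seq (X * Y)) (sg : strategy X Y) a :
  (forall ms, size ms = n.+1 -> partial_iso (ps ++ play sg [::] ms)) ->
  winnable n (round sg [::] a :: ps) /\ partial_iso (round sg [::] a :: ps).
Proof.
move=> win; split.
  exists (after sg a) => ms sz; have := win (a :: ms); rewrite /= sz play_after.
  move=> /(_ erefl); apply: partial_iso_sub => p.
  by rewrite !(mem_cat, inE); case: (p \in ps); case: (p == _).
(* Any play of full length that starts with [a] would do; repeating [a] gives one. *)
have := win (nseq n.+1 a); rewrite size_nseq => /(_ erefl).
by apply: partial_iso_sub => p; rewrite !(mem_cat, inE); case: (p \in ps); case: (p == _).
Qed.

(** Preserving the order forces a move in a gap to be answered in the corresponding gap. The new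
    pair cuts this gap in two, and the halves are the gaps of [c] extended by [true] or [false] at
    the new pair. *)
Lemma winnable_bf (X Y : linorder) n (ps : seq (X * Y)) c :
  winnable n ps -> bf n (@lo_lt X) (@lo_lt Y) (gapl ps c) (gapr ps c).
Proof.
elim: n ps c => // n IH ps c [sg win].
have split_gap x y d : (x, y) \notin ps ->
    (forall z, gapl ((x, y) :: ps) (fun p => if p == (x, y) then d else c p) z <->
      (if d then below else above) _ (@lo_lt X) (gapl ps c) x z) /\
    (forall z, gapr ((x, y) :: ps) (fun p => if p == (x, y) then d else c p) z <->
      (if d then below else above) _ (@lo_lt Y) (gapr ps c) y z).
  move=> xy; split=> z; split.
  - move=> g; have := g (x, y) (mem_head _ _); rewrite eqxx => gx.
    have gz : gapl ps c z.
      move=> p pps; have := g p; rewrite inE pps orbT => /(_ isT).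
      by case: eqP pps xy => // -> ->.
    by case: (d) gx => gx; split.
  - move=> H p; rewrite inE; case: eqP => [-> _|_ /= pps]; last first.
      by case: (d) H => -[gz _]; apply: gz.
    by case: (d) H => -[].
  - move=> g; have := g (x, y) (mem_head _ _); rewrite eqxx => gx.
    have gz : gapr ps c z.
      move=> p pps; have := g p; rewrite inE pps orbT => /(_ isT).
      by case: eqP pps xy => // -> ->.
    by case: (d) gx => gx; split.
  - move=> H p; rewrite inE; case: eqP => [-> _|_ /= pps]; last first.
      by case: (d) H => -[gz _]; apply: gz.
    by case: (d) H => -[].
have step x y : winnable n ((x, y) :: ps) -> (x, y) \notin ps ->
    bf n (@lo_lt X) (@lo_lt Y) (below (@lo_lt X) (gapl ps c) x)
      (below (@lo_lt Y) (gapr ps c) y) /\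
    bf n (@lo_lt X) (@lo_lt Y) (above (@lo_lt X) (gapl ps c) x)
      (above (@lo_lt Y) (gapr ps c) y).
  move=> w /[dup] /(split_gap x y true)[l1 r1] /(split_gap x y false)[l2 r2].
  by split; [apply: bf_ext l1 r1 _|apply: bf_ext l2 r2 _]; apply: IH.
split=> [x gx|y gy].
  have [w iso] := winnable_after (inl x) win.
  set y := reply_inY sg [::] x in w iso.
  exists y; last first.
    apply: step => //; apply/negP => /gx /=; case: (c _); exact: (proj1 (strict_lo_lt _)).
  move=> p pps; have [_ e1] := iso p (x, y) (mem_behead (s := _ :: _) pps) (mem_head _ _).
  have [_ e2] := iso (x, y) p (mem_head _ _) (mem_behead (s := _ :: _) pps).
  by move: (gx p pps); rewrite /lo_lt /= in e1 e2 *; rewrite e1 e2.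
have [w iso] := winnable_after (inr y) win.
set x := reply_inX sg [::] y in w iso.
exists x; last first.
  have [] : _ /\ _ := step x y w _.
    apply/negP => /gy /=; case: (c _); exact: (proj1 (strict_lo_lt _)).
  by split; apply: bf_sym.
move=> p pps; have [_ e1] := iso p (x, y) (mem_behead (s := _ :: _) pps) (mem_head _ _).
have [_ e2] := iso (x, y) p (mem_head _ _) (mem_behead (s := _ :: _) pps).
by move: (gy p pps); rewrite /lo_lt /= in e1 e2 *; rewrite e1 e2.
Qed.

Definition gap_equiv (X Y : linorder) n (ps : seq (X * Y)) := partial_iso ps /\
  forall c, bf n (@lo_lt X) (@lo_lt Y) (gapl ps c) (gapr ps c).

Lemma gap_equiv_repeat (X Y : linorder) n (ps : seq (X * Y)) p :
  p \in ps -> gap_equiv n.+1 ps -> gap_equiv n (p :: ps).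
Proof.
move=> pps [iso gap]; have sub : {subset p :: ps <= ps}.
  by move=> q; rewrite inE => /predU1P[->|].
split=> [|c]; first exact: partial_iso_sub iso.
apply: bf_ext (bf_pred (gap c)) => z; split=> g q;
  by first [move=> /sub; exact: g | move=> qps; apply: g; rewrite inE qps orbT].
Qed.

(** If [d] agrees with [c] on [ps], its gap is one of the halves of the gap that was cut. If they
    differ at [p], then [x] and the points allowed by [d] lie on opposite sides of [p.1]. So the
    condition at the new pair either follows from the one at [p], and the gap is unchanged, or
    contradicts it, and the gap is empty; likewise for [y]. *)
Lemma gap_equiv_cons (X Y : linorder) n (ps : seq (X * Y)) c x y :
  gap_equiv n.+1 ps -> gapl ps c x -> gapr ps c y ->
  bf n (@lo_lt X) (@lo_lt Y) (below (@lo_lt X) (gapl ps c) x)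
    (below (@lo_lt Y) (gapr ps c) y) ->
  bf n (@lo_lt X) (@lo_lt Y) (above (@lo_lt X) (gapl ps c) x)
    (above (@lo_lt Y) (gapr ps c) y) ->
  gap_equiv n ((x, y) :: ps).
Proof.
move=> [iso gap] gx gy lo hi; split=> [p q|d].
  have cmp r : r \in ps -> [/\ (x == r.1) = (y == r.2), (x < r.1)%O = (y < r.2)%O
      & (r.1 < x)%O = (r.2 < y)%O].
    move=> /[dup] /gx + /gy; rewrite /lo_lt.
    by case: (c r) => ltx lty; rewrite !(lt_gtF ltx, lt_gtF lty, lt_eqF ltx,
      lt_eqF lty, gt_eqF ltx, gt_eqF lty) ltx lty.
  rewrite !inE => /predU1P[->|pps] /predU1P[->|qps]; last exact: iso.
  - by rewrite /= !eqxx !ltxx.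
  - by have [] := cmp q qps.
  - by have [e _ ?] := cmp p pps; rewrite eq_sym e eq_sym.
have [/allP agree|/allPn[p pps]] := boolP (all (fun p => d p == c p) ps).
  have El : forall z, (if d (x, y) then below else above) _ (@lo_lt X) (gapl ps c) x z <->
      gapl ((x, y) :: ps) d z.
    move=> z; split.
      move=> H p; rewrite inE => /predU1P[->|pps]; first by case: (d _) H => -[].
      rewrite (eqP (agree p pps)); case: (d _) H => -[g _]; exact: g.
    move=> g; have gz : gapl ps c z.
      move=> p pps; rewrite -(eqP (agree p pps)); apply: g; by rewrite inE pps orbT.
    by have := g _ (mem_head _ _); case: (d _); split.
  have Er : forall z, (if d (x, y) then below else above) _ (@lo_lt Y) (gapr ps c) y z <->
      gapr ((x, y) :: ps) d z.
    move=> z; split.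
      move=> H p; rewrite inE => /predU1P[->|pps]; first by case: (d _) H => -[].
      rewrite (eqP (agree p pps)); case: (d _) H => -[g _]; exact: g.
    move=> g; have gz : gapr ps c z.
      move=> p pps; rewrite -(eqP (agree p pps)); apply: g; by rewrite inE pps orbT.
    by have := g _ (mem_head _ _); case: (d _); split.
  by apply: bf_ext El Er _; case: (d _).
move=> dc; have trX := proj2 (strict_lo_lt X); have trY := proj2 (strict_lo_lt Y).
have irX := proj1 (strict_lo_lt X); have irY := proj1 (strict_lo_lt Y).
move: (gx p pps) (gy p pps).
have pps' : p \in (x, y) :: ps by rewrite inE pps orbT.
have [e|ne] := eqVneq (d (x, y)) (d p).
  move=> px py; apply: bf_ext (bf_pred (gap d)) => z; split=> g q.
  - rewrite inE => /predU1P[->|]; last exact: g.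
    move: (g p pps) dc px; rewrite e; case: (d p) => gp; case: (c p) => // _ px.
      exact: trX gp px.
    exact: trX px gp.
  - by move=> qps; apply: g; rewrite inE qps orbT.
  - rewrite inE => /predU1P[->|]; last exact: g.
    move: (g p pps) dc py; rewrite e; case: (d p) => gp; case: (c p) => // _ py.
      exact: trY gp py.
    exact: trY py gp.
  - by move=> qps; apply: g; rewrite inE qps orbT.
move=> px py; apply: bf_empty => z g;
  move: (g _ (mem_head _ _)) (g p pps') ne dc px py.
  case: (d (x, y)); case: (d p) => //= zx zp _; case: (c p) => // _ px _.
    exact: (irX z (trX _ _ _ (trX _ _ _ zx px) zp)).
  exact: (irX z (trX _ _ _ (trX _ _ _ zp px) zx)).
case: (d (x, y)); case: (d p) => //= zx zp _; case: (c p) => // _ _ py.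
  exact: (irY z (trY _ _ _ (trY _ _ _ zx py) zp)).
exact: (irY z (trY _ _ _ (trY _ _ _ zp py) zx)).
Qed.

Lemma gap_equiv_reply (X Y : linorder) n (ps : seq (X * Y)) :
  gap_equiv n.+1 ps -> forall a : move X Y, exists p,
    gap_equiv n (p :: ps) /\
    match a with inl x => p.1 = x | inr y => p.2 = y end.
Proof.
move=> G [x|y].
  have [/mapP[p pps ->]|xps] := boolP (x \in map fst ps).
    by exists p; split=> //; apply: gap_equiv_repeat.
  (* This selects the gap that contains [x]. *)
  pose c (p : X * Y) := (x < p.1)%O.
  have gx : gapl ps c x.
    move=> p pps; rewrite /c /lo_lt; case: ltgtP => // e.
    by move: xps; rewrite e map_f.
  have [y gy [lo hi]] := bf_forth (proj2 G c) gx.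
  by exists (x, y); split=> //; apply: gap_equiv_cons gx gy lo hi.
have [/mapP[p pps ->]|yps] := boolP (y \in map snd ps).
  by exists p; split=> //; apply: gap_equiv_repeat.
pose c (p : X * Y) := (y < p.2)%O.
have gy : gapr ps c y.
  move=> p pps; rewrite /c /lo_lt; case: ltgtP => // e.
  by move: yps; rewrite e map_f.
have [x gx [lo hi]] := bf_forth (bf_sym (proj2 G c)) gy.
by exists (x, y); split=> //; apply: gap_equiv_cons gx gy (bf_sym lo) (bf_sym hi).
Qed.

Lemma gap_equiv_winnable (X Y : linorder) (x0 : X) (y0 : Y) n (ps : seq (X * Y)) :
  gap_equiv n ps -> winnable n ps.
Proof.
elim: n ps => [|n IH] ps G.
  exists (Strategy (fun _ _ => y0) (fun _ _ => x0)) => -[] //= _.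
  by rewrite cats0; case: G.
(* For each first move [a], [f a] holds the resulting pair and a strategy for the rest. The combined
   strategy plays the pair and then follows [(f a).2] with [a] dropped from the history. *)
have /boolp.choice[f fP] a : exists psg : (X * Y) * strategy X Y,
    (forall ms, size ms = n -> partial_iso ((psg.1 :: ps) ++ play psg.2 [::] ms)) /\
    match a with inl x => psg.1.1 = x | inr y => psg.1.2 = y end.
  have [p [/IH[sg win] ap]] := gap_equiv_reply G a.
  by exists (p, sg).
exists (Strategy
  (fun h x => if h is a :: h' then reply_inY (f a).2 h' x else (f (inl x)).1.2)
  (fun h y => if h is a :: h' then reply_inX (f a).2 h' y else (f (inr y)).1.1)).
case=> // a ms [sz]; set sg := Strategy _ _.
have playE h : play sg (a :: h) ms = play (f a).2 h ms.
  rewrite play_after; elim: ms h {sz} => // b ms IHms h /=.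
  by rewrite IHms; case: b.
have [win fa] := fP a; have := win ms sz; rewrite /= playE.
have -> : round sg [::] a = (f a).1.
  by case: a fa {playE win} => [x|y] e; rewrite [RHS]surjective_pairing e.
by apply: partial_iso_sub => q; rewrite !(mem_cat, inE); case: (q \in ps); case: (q == _).
Qed.

Lemma ef_equivP (X Y : linorder) (x0 : X) (y0 : Y) n :
  ef_equiv X Y n <-> bf n (@lo_lt X) (@lo_lt Y) (@full _) (@full _).
Proof.
split=> [[sg win]|E].
  have : winnable n ([::] : seq (X * Y)) by exists sg.
  by move=> /(@winnable_bf _ _ _ _ xpred0); apply: bf_ext.
apply: (@gap_equiv_winnable _ _ x0 y0 n [::]); split=> // c.
by apply: bf_ext E.
Qed.

(** * Products of linear orders as lists of factors *)

(** Such an [f] is an isomorphism: it is injective since [X] is linear and [wlt] is irreflexive. *)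
Definition represents (l : seq bool) (X : linorder) := exists f : X -> carrier l,
  (forall z, exists x, f x = z) /\ forall x y, lo_lt x y <-> wlt (f x) (f y).

Lemma represents_bf n l X : represents l X ->
  bf n (@lo_lt X) (@wlt l) (@full _) (@full _).
Proof.
case=> f [sur mono]; apply: (@bf_iso _ _ _ (fun x z => f x = z)).
- by move=> x _ y _ <- <-.
- by move=> x _; exists (f x).
- by move=> z _; have [x <-] := sur z; exists x.
Qed.

Lemma represents_equiv n l l' X Y : represents l X -> represents l' Y ->
  ef_equiv X Y n <-> wequiv n l l'.
Proof.
move=> rX rY; have bX := represents_bf n rX; have bY := represents_bf n rY.
have [f [surf _]] := rX; have [g [surg _]] := rY.
have [x0 _] := surf (origin l); have [y0 _] := surg (origin l').
rewrite (ef_equivP x0 y0); split=> E.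
  exact: bf_trans (bf_trans (bf_sym bX) E) bY.
exact: bf_trans (bf_trans bX E) (bf_sym bY).
Qed.

Fixpoint join l l' : carrier l -> carrier l' -> carrier (l ++ l') :=
  if l is b :: k then fun x y => (join x.1 y, x.2) else fun _ y => y.

Lemma join_sur l l' (z : carrier (l ++ l')) : exists x y, join (l := l) x y = z.
Proof.
elim: l z => [|b l IH] z; first by exists tt, z.
by case: z => z i; have [x [y <-]] := IH z; exists (x, i), y.
Qed.

Lemma join_inj l l' (x x' : carrier l) (y y' : carrier l') :
  join x y = join x' y' -> x = x' /\ y = y'.
Proof.
elim: l x x' => [|b l IH]; first by case; case.
by case=> x i [x' i'] [/IH[-> ->] ->].
Qed.

(** Associativity of the product: the factors in [l'] are the more significant ones. *)
Lemma wlt_join l l' (x x' : carrier l) (y y' : carrier l') :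
  wlt (join x y) (join x' y') <-> wlt y y' \/ y = y' /\ wlt x x'.
Proof.
elim: l x x' => [|b l IH] x x'; first by split; [left|case=> // -[_ []]].
have J := @join_inj l l'.
case: x x' => x i [x' i']; rewrite /= /dir /lexn /=.
case: b; rewrite IH; (split; last by case=> [|[-> [?|[-> ?]]]];
    [left; left|left; right|right]).
  case=> [[|[? ?]]|[/J[? ?] ?]]; [by left|by right; split; [|left]|].
  by right; split; [|right].
case=> [[|[? ?]]|[/J[? ?] ?]]; [by left|by right; split; [|left]|].
by right; split; [|right].
Qed.

Lemma represents_one : represents [::] lo_one.
Proof.
exists (fun=> tt); split=> [[]|x y]; first by exists ord0.
by rewrite (ord1 x) (ord1 y); split=> //; rewrite /lo_lt ltxx.
Qed.

Lemma represents_omega : represents [:: true] omega.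
Proof.
exists (fun i : nat => (tt, i)); split=> [[[] i]|i j]; first by exists i.
by rewrite /lo_lt /= /lexn /=; split=> [ij|[//|[]]]; first by right.
Qed.

Lemma represents_omega_star : represents [:: false] omega_star.
Proof.
exists (fun i : nat => (tt, i)); split=> [[[] i]|i j]; first by exists i.
by rewrite /lo_lt /= /lexn /=; split=> [ij|[//|[]]]; first by right.
Qed.

Lemma represents_mul l l' X Y : represents l X -> represents l' Y ->
  represents (l ++ l') (lo_mul X Y).
Proof.
move=> [f [surf f_lt]] [g [surg g_lt]].
(* An element of [lo_mul X Y] is stored with its [Y] component first. *)
exists (fun z : lo_mul X Y => join (f z.2) (g z.1)); split.
  move=> z; have [a [b <-]] := join_sur z.
  by have [x <-] := surf a; have [y <-] := surg b; exists (y, x).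
move=> [y x] [y' x']; rewrite wlt_join -f_lt -g_lt /= /lo_lt ltEprodlexi /=.
have g_inj : g y = g y' -> y = y'.
  move=> e; case: (ltgtP y y') => // /g_lt; rewrite e; by case/(proj1 (strict_wlt _)).
split.
  case: (ltgtP y y') => //= [lt_y _|->]; first by left.
  by right.
by case=> [lt_y|[/g_inj -> lt_x]]; [rewrite ltW // leNgt lt_y|rewrite lexx].
Qed.

Lemma represents_prod (L : nat -> seq bool) (X : nat -> linorder) k :
  (forall i, i < k -> represents (L i) (X i)) ->
  represents (flatten [seq L i | i <- iota 0 k]) (lo_prod X k).
Proof.
elim: k => [_|k IH rX]; first exact: represents_one.
rewrite -addn1 iotaD map_cat flatten_cat /= cats0 addn1.
case: k IH rX => [|k] IH rX; first exact: rX.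
by apply: represents_mul; [apply: IH => i ik; apply: rX; apply: ltnW|apply: rX].
Qed.

Lemma represents_exp b M k : represents [:: b] M -> represents (nseq k b) (lo_exp M k).
Proof.
move=> rM; have := @represents_prod (fun=> [:: b]) (fun=> M) k (fun _ _ => rM).
suff -> : flatten [seq [:: b] | _ <- iota 0 k] = nseq k b by [].
by elim: k 0 => //= k IH i; rewrite IH.
Qed.

(** * Blocks of equal factors and the value of l(A, B) *)

Definition blocks (b : nat -> bool) (m : nat -> nat) i k :=
  flatten [seq nseq (m j) (b j) | j <- iota i k].

Lemma size_blocks b m k : size (blocks b m 0 k) = \sum_(i < k) m i.
Proof.
rewrite /blocks size_flatten /shape -map_comp sumnE big_map -(big_mkord xpredT m).
by rewrite /index_iota subn0; apply: eq_bigr => i _; rewrite /= size_nseq.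
Qed.

Lemma blocks_cat b m i j k :
  blocks b m i (j + k) = blocks b m i j ++ blocks b m (i + j) k.
Proof. by rewrite /blocks iotaD map_cat flatten_cat. Qed.

Lemma mem_blocks b m i k j : i <= j < i + k -> 0 < m j -> b j \in blocks b m i k.
Proof.
move=> ijk mj; apply/flattenP; exists (nseq (m j) (b j)).
  by apply/mapP; exists j => //; rewrite mem_iota.
by rewrite mem_nseq mj eqxx.
Qed.

Theorem theorem3p4 (s : nat) (M : nat -> linorder) (m n : nat -> nat)
    (hs : 1 <= s)
    (hM : forall i, i < s -> M i = omega \/ M i = omega_star)
    (halt : forall i, i.+1 < s -> M i.+1 <> M i)
    (hm : forall i, i < s -> 0 < m i)
    (hn : forall i, i < s -> 0 < n i)
    (t : nat) (ht : t < s)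
    (htmin : forall i, i < t -> m i = n i)
    (hlt : m t < n t) :
  let A := lo_prod (fun i => lo_exp (M i) (m i)) s in
  let B := lo_prod (fun i => lo_exp (M i) (n i)) s in
  (t.+1 = s -> is_l A B (2 * \sum_(i < t.+1) m i)) /\
  (t.+2 = s -> is_l A B (2 * (\sum_(i < t.+1) m i) + 1)) /\
  (t.+2 < s -> is_l A B (2 * (\sum_(i < t.+1) m i) + 2)).
Proof.
move=> A B.
have [b Mb] : exists b : nat -> bool,
    forall i, i < s -> M i = if b i then omega else omega_star.
  have /boolp.choice[b bP] i : exists c : bool,
      i < s -> M i = if c then omega else omega_star.
    case: (ltnP i s) => [/hM[e|e]|_]; [by exists true|by exists false|by exists true].
  by exists b.
have b_alt i : i.+1 < s -> b i.+1 = ~~ b i.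
  move=> lt_is; have := halt i lt_is; rewrite !Mb //; last exact: ltnW.
  by case: (b i); case: (b i.+1).
have rep k : represents (blocks b k 0 s) (lo_prod (fun i => lo_exp (M i) (k i)) s).
  apply: represents_prod => i lt_is; apply: represents_exp; rewrite Mb //.
  by case: (b i); [apply: represents_omega|apply: represents_omega_star].
have eqAB k := represents_equiv k (rep m) (rep n); rewrite -/A -/B in eqAB.
have mt := hm t ht; have nt := hn t ht.
set p := blocks b m 0 t.
have pn : blocks b n 0 t = p.
  rewrite /p /blocks; congr flatten; apply/eq_in_map => i.
  by rewrite mem_iota => /htmin ->.
have split_at k r : s = t.+1 + r ->
    blocks b k 0 s = blocks b k 0 t ++ nseq (k t) (b t) ++ blocks b k t.+1 r.
  by move=> ->; rewrite -addn1 !blocks_cat add0n -catA /blocks /= cats0 addn1.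
have sumE : \sum_(i < t.+1) m i = size p + m t by rewrite big_ord_recr /= size_blocks.
have is_lP k : 0 < k -> wequiv k (blocks b m 0 s) (blocks b n 0 s) ->
    ~ wequiv k.+1 (blocks b m 0 s) (blocks b n 0 s) -> is_l A B k.
  by move=> k0 E NE; split=> //; split; [apply/eqAB|move=> /eqAB].
(* Once [(m t).-1] common factors of block [t] are split off, one factor [b t] of this block is left
   in A and [d.+2] in B. *)
pose d := n t - (m t).+1.
have ntE : nseq (n t) (b t) = nseq (m t).-1 (b t) ++ nseq d.+2 (b t).
  by rewrite -nseqD /d; congr nseq; lia.
have mtE : nseq (m t) (b t) = nseq (m t).-1 (b t) ++ [:: b t].
  by rewrite -[[:: _]]/(nseq 1 (b t)) -nseqD; congr nseq; lia.
(* The common prefix to strip stops one factor short of all that A has in blocks 0 to [t], so twice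
   the sum is [2 * size q + 2]. *)
set q := p ++ nseq (m t).-1 (b t).
have sz_q : (size q).+1 = size p + m t by rewrite size_cat size_nseq; lia.
have [r sE] : exists r, t.+1 < s -> s = t.+1 + r.+1 by exists (s - t.+2); lia.
have AE : t.+1 < s -> blocks b m 0 s = q ++ b t :: blocks b m t.+1 r.+1.
  by move=> /sE sE'; rewrite (split_at _ _ sE') mtE /q -!catA.
have BE : t.+1 < s -> blocks b n 0 s =
    q ++ b t :: b t :: nseq d (b t) ++ blocks b n t.+1 r.+1.
  by move=> /sE sE'; rewrite (split_at _ _ sE') pn ntE /q -!catA.
have btN k : t.+1 < s -> (forall i, i < s -> 0 < k i) ->
    ~~ b t \in blocks b k t.+1 r.+1.
  by move=> ts k_gt0; rewrite -b_alt //; apply: mem_blocks; [lia|apply: k_gt0].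
have mem_all c (l : seq bool) : c \in l -> ~~ c \in l -> forall c', c' \in l.
  by move=> cl ncl c'; have [->//|ne] := eqVneq c' c; move: ne ncl; case: (c); case: (c').
have btB : t.+1 < s -> ~~ b t \in b t :: nseq d (b t) ++ blocks b n t.+1 r.+1.
  by move=> ts; rewrite inE mem_cat btN // !orbT.
have allA : t.+1 < s -> forall c, c \in b t :: blocks b m t.+1 r.+1.
  by move=> ts; apply: (mem_all (b t)); rewrite inE ?eqxx // btN ?orbT.
have allB : t.+1 < s ->
    forall c, c \in b t :: b t :: nseq d (b t) ++ blocks b n t.+1 r.+1.
  by move=> ts; apply: (mem_all (b t)); rewrite inE ?eqxx // btB ?orbT.
rewrite sumE; split; last split.
- move=> ts; have s0 : s = t.+1 + 0 by rewrite addn0.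
  apply: is_lP; first by lia.
    rewrite !(split_at _ _ s0) pn -/p !cats0.
    have E := wequiv_pow (b t) mt (ltnW hlt).
    case: (posnP t) => [t0|t_gt0].
      by move: E; rewrite /p t0 /= add0n.
    (* The powers of [b t] alone do not contain both kinds of factor. The last factor of [p] is
       [~~ b t], and moving it to the remainder makes [wequiv_cat] applicable. *)
    have [p' pE] : exists p', p = rcons p' (~~ b t).
      exists (blocks b m 0 t.-1 ++ nseq (m t.-1).-1 (b t.-1)).
      have e : t = t.-1 + 1 by lia.
      rewrite /p [in LHS]e blocks_cat add0n /blocks /= cats0 rcons_cat; congr cat.
      have -> : ~~ b t = b t.-1 by rewrite -{1}(prednK t_gt0) b_alt ?negbK; lia.
      by have := hm t.-1; case: (m t.-1) => [|k _]; [lia|rewrite -[RHS]cats1 -(nseqD k 1) addn1].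
    rewrite pE size_rcons !cat_rcons.
    have -> : 2 * ((size p').+1 + m t) = 2 * size p' + (2 * m t).+2 by lia.
    have bt k : 0 < k -> forall c, c \in ~~ b t :: nseq k (b t).
      by move=> k0 c; rewrite inE mem_nseq k0; case: c; case: (b t).
    apply: wequiv_cat; [exact: bt|exact: bt|].
    by apply: wequiv_cons => //; rewrite negbK mem_nseq eqxx ?mt ?nt.
  rewrite !(split_at _ _ s0) pn -/p !cats0 mtE ntE !catA => E.
  apply: (@not_wequiv_pow (b t) d).
  apply: (@wequiv_drop_cat 3 q).
  suff -> : 2 * size q + 3 = (2 * (size p + m t)).+1 by [].
  by rewrite -sz_q; lia.
- move=> ts; have ts' : t.+1 < s by rewrite -ts.
  have r0 : r = 0 by lia.
  apply: is_lP; rewrite ?addn1 // AE // BE // -sz_q.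
    have -> : (2 * (size q).+1).+1 = 2 * size q + 3 by lia.
    apply: wequiv_cat; [exact: allA|exact: allB|].
    (* Of the 3 moves, [wequiv_cons] accounts for 2, and 1 is left for nonempty orders. *)
    by apply: wequiv_cons (wequiv_1 _ _); [apply: btN|apply: btB].
  have -> : (2 * (size q).+1).+2 = 2 * size q + 4 by lia.
  (* With 2 moves left, the rest of A is a power of [~~ b t], while the rest of B still contains
     [b t]. *)
  move=> /wequiv_drop_cat/wequiv_behead; rewrite r0.
  have -> : blocks b m t.+1 1 = nseq (m t.+1) (~~ b t).
    by rewrite /blocks /= cats0 b_alt.
  by apply: not_wequiv_2; apply: mem_head.
- move=> ts; have ts' : t.+1 < s by apply: ltnW.
  (* Since the factors alternate, block [t.+2] has the same kind as block [t], so what follows block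
     [t] contains both kinds. *)
  have bt k : (forall i, i < s -> 0 < k i) -> b t \in blocks b k t.+1 r.+1.
    move=> k_gt0; have <- : b t.+2 = b t by rewrite !b_alt ?negbK.
    by apply: mem_blocks; [have := sE ts'; lia|apply: k_gt0].
  apply: is_lP; rewrite ?addn2 // AE // BE // -sz_q.
    have -> : (2 * (size q).+1).+2 = 2 * size q + 4 by lia.
    apply: wequiv_cat; [exact: allA|exact: allB|].
    apply: wequiv_cons; [exact: btN|exact: btB|].
    apply: wequiv_2; apply: (mem_all (b t)); rewrite ?mem_head ?btN ?btB //.
    exact: bt.
  have -> : (2 * (size q).+1).+3 = 2 * size q + 5 by lia.
  (* With 3 moves left, the rest of A starts with [~~ b t] and the rest of B with [b t]. *)
  move=> /wequiv_drop_cat/wequiv_behead.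
  rewrite /blocks /= b_alt //; move: (hm _ ts'); case: (m t.+1) => // k _.
  exact: not_wequiv_3.
Qed.
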